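(* Let $I=[0,1]$ or $I=[0,\infty)$ and let $X$ be a Banach function space on $I$ such that the abstract Copson function space $C^*X$ satisfies $C^*X\neq\{0\}$. Then there are numbers $0<a<b<m(I)$ such that $$\|\chi_{[0,a]}\|_X\,\|f\|_{L^1(1/t)(I)}\le\|f\|_{C^*X}\le\|\chi_{[0,b]}\|_X\,\|f\|_{L^1(1/t)(I)}$$ for all $f\in C^*X$ with $\operatorname{supp}(f)\subset[a,b]$. In particular, $C^*X$ contains a complemented copy of $L^1[0,1]$ (a complemented closed subspace isomorphic to $L^1[0,1]$).
   Context: $m$ is Lebesgue measure on $I$ (so $m(I)=1$ or $\infty$), and $L^0(I)$ is the space of (a.e. equivalence classes of) real-valued Lebesgue measurable functions on $I$. A Banach function space $X$ on $I$ is a Banach space that is a linear subspace of $L^0(I)$ with the ideal property: $|f|\le|g|$ a.e., $f\in L^0(I)$, $g\in X$ imply $f\in X$ and $\|f\|_X\le\|g\|_X$; by convention $X$ is also assumed to contain a function positive a.e. on $I$ (this is not assumed for the derived space $C^*X$). $\operatorname{supp}(f)=\{x\in I: f(x)\ne0\}$. $\|f\|_{L^1(1/t)(I)}=\int_I |f(t)|\,\frac{dt}{t}$. Copson operator: $C^*f(x)=\int_{I\cap[x,\infty)}\frac{f(t)}{t}\,dt$ for $x\in I$. Abstract Copson function space: $C^*X=\{f\in L^0(I): C^*|f|\in X\}$ with norm $\|f\|_{C^*X}=\|C^*|f|\|_X$. *)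

(* Defs.v *)
From HB Require Import structures.
From mathcomp Require Import all_boot all_order all_algebra.
From mathcomp Require Import all_classical all_reals all_analysis.
From mathcomp Require Import measurable_realfun.
Set Implicit Arguments.
Unset Strict Implicit.
Unset Printing Implicit Defensive.
Import Order.TTheory GRing.Theory Num.Theory.
Import numFieldNormedType.Exports.
Local Open Scope classical_set_scope.
Local Open Scope ring_scope.
Local Open Scope quotient_scope.

Section L0.
Context d (T : measurableType d) (R : realType).
Variable mu : {measure set T -> \bar R}.

(* The quotient of the measurable functions by equality almost everywhere is
   the library's; here it is given the structure of a vector space. *)
Definition L0 : Type := {mfun_ mu, T >-> R}.
HB.instance Definition _ := Choice.on L0.
HB.instance Definition _ := EqQuotient.on L0.

Definition L0_fun (f : L0) : {mfun T >-> R} := repr f.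
Coercion L0_fun : L0 >-> MeasurableFun.type.

Definition L0_class (f : {mfun T >-> R}) : L0 := \pi_L0 f.

Lemma L0_classE (f : {mfun T >-> R}) : L0_class f = f %[ae mu].
Proof.
have /eqquotP/asboolP : repr (\pi_L0 f) = f %[mod L0] by rewrite reprK.
by [].
Qed.

Lemma L0_eqP (f g : L0) : f = g %[ae mu] <-> f = g.
Proof.
split => [fg|->]; last exact: ae_eq_refl.
by rewrite -[f]reprK -[g]reprK; apply/eqquotP/asboolP.
Qed.

Definition L0_add (f g : L0) := L0_class ((f : {mfun T >-> R}) + (g : {mfun T >-> R})).
Definition L0_opp (f : L0) := L0_class (- (f : {mfun T >-> R})).
Definition L0_scale (a : R) (f : L0) := L0_class (a *: (f : {mfun T >-> R})).
Definition L0_zero := L0_class 0.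

Let addE f g : L0_add f g = f \+ g %[ae mu]. Proof. exact: L0_classE. Qed.
Let oppE f : L0_opp f = \- f %[ae mu]. Proof. exact: L0_classE. Qed.
Let scaleE a f : L0_scale a f = a \*: f %[ae mu]. Proof. exact: L0_classE. Qed.
Let zeroE : L0_zero = cst 0 %[ae mu]. Proof. exact: L0_classE. Qed.

Let addA : associative L0_add.
Proof.
move=> f g h; apply/L0_eqP.
apply: filterS2 (filterI (addE g h) (addE f g))
  (filterI (addE (L0_add f g) h) (addE f (L0_add g h))).
move=> x [] /(_ I) /= e1 /(_ I) /= e2 [] /(_ I) /= e3 /(_ I) /= e4 _.
by rewrite e4 e3 e1 e2 addrA.
Qed.

Let addC : commutative L0_add.
Proof. by move=> f g; rewrite /L0_add GRing.addrC. Qed.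

Let add0 : left_id L0_zero L0_add.
Proof.
move=> f; apply/L0_eqP; have := addE L0_zero f; have := zeroE.
by apply: filterS2 => x /(_ I) /= e1 /(_ I) /= e2 _; rewrite e2 e1 add0r.
Qed.

Let addN : left_inverse L0_zero L0_opp L0_add.
Proof.
move=> f; apply/L0_eqP; have := addE (L0_opp f) f; have := zeroE; have := oppE f.
apply: filterS3 => x /(_ I) /= e1 /(_ I) /= e2 /(_ I) /= e3 _.
by rewrite e3 e2 e1 addNr.
Qed.

HB.instance Definition _ := GRing.isZmodule.Build L0 addA addC add0 addN.

Let scaleA a b (f : L0) : L0_scale a (L0_scale b f) = L0_scale (a * b) f.
Proof.
apply/L0_eqP.
have := scaleE a (L0_scale b f); have := scaleE b f; have := scaleE (a * b) f.
apply: filterS3 => x /(_ I) /= e1 /(_ I) /= e2 /(_ I) /= e3 _.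
by rewrite e3 e2 e1 scalerA.
Qed.

Let scale1 : left_id 1 L0_scale.
Proof.
move=> f; apply/L0_eqP; have := scaleE 1 f; apply: filterS => x.
by move=> /[apply] /= ->; rewrite scale1r.
Qed.

Let scaleDr : right_distributive L0_scale +%R.
Proof.
move=> a f g; apply/L0_eqP.
apply: filterS2 (filterI (scaleE a (f + g)) (scaleE a f)) (filterI (scaleE a g)
  (filterI (addE f g) (addE (L0_scale a f) (L0_scale a g)))) => x.
move=> [] /(_ I) /= e1 /(_ I) /= e2 [] /(_ I) /= e3 [] /(_ I) /= e4 /(_ I) /= e5 _.
rewrite e1 [(_ + _ : L0) x]e4 [RHS]e5 e2 e3 scalerDr //.
Qed.

Let scaleDl f : {morph L0_scale^~ f : a b / a + b}.
Proof.
move=> a b; apply/L0_eqP.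
apply: filterS2 (filterI (scaleE (a + b) f) (scaleE a f))
  (filterI (scaleE b f) (addE (L0_scale a f) (L0_scale b f))) => x.
move=> [] /(_ I) /= e1 /(_ I) /= e2 [] /(_ I) /= e3 /(_ I) /= e4 _.
by rewrite e1 [RHS]e4 e2 e3 scalerDl.
Qed.

HB.instance Definition _ := GRing.Zmodule_isLmodule.Build R L0
  scaleA scale1 scaleDr scaleDl.

Lemma L0_addE (f g : L0) : (f + g : L0) = f \+ g %[ae mu]. Proof. exact: addE. Qed.
Lemma L0_oppE (f : L0) : (- f : L0) = \- f %[ae mu]. Proof. exact: oppE. Qed.
Lemma L0_scaleE a (f : L0) : (a *: f : L0) = a \*: f %[ae mu]. Proof. exact: scaleE. Qed.
Lemma L0_zeroE : (0 : L0) = cst 0 %[ae mu]. Proof. exact: zeroE. Qed.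

End L0.

(* The real line with the sigma-algebra of Lebesgue (not just Borel) measurable
   sets, and the complete Lebesgue measure on it. *)
Definition lebT (R : realType) : measurableType _ :=
  caratheodory_type (@wlength R idfun)^*%mu.
Definition leb (R : realType) : {measure set (lebT R) -> \bar R} :=
  @completed_lebesgue_measure R.
Arguments leb {R}.

Variant base_interval := UnitInterval | HalfLine.
Definition base_set (R : realType) (J : base_interval) : set (lebT R) :=
  match J with UnitInterval => `[0, 1] | HalfLine => `[0, +oo[ end.
Arguments base_set {R}.

Lemma measurable_lebT_itv (R : realType) (i : interval R) :
  measurable ([set` i] : set (lebT R)).
Proof. by apply: sub_caratheodory; exact: (measurable_itv i). Qed.

Lemma measurable_base_set (R : realType) (J : base_interval) :
  measurable (@base_set R J).
Proof. by case: J; exact: measurable_lebT_itv. Qed.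

(* Functions on I are represented by functions on R up to lebI-a.e. equality:
   lebI ignores everything outside I. *)
Definition lebI (R : realType) (J : base_interval) : {measure set (lebT R) -> \bar R} :=
  mrestr leb (@measurable_base_set R J).
Arguments lebI {R}.


Section ideal_space.
Context d (T : measurableType d) (R : realType).
Variable mu : {measure set T -> \bar R}.
Local Notation L0 := (L0 mu).

(* A normed linear subspace of L0 with the ideal property, neither assumed to be
   complete nor to contain an a.e. positive function. ideal_norm is meaningless
   outside of ideal_carrier. *)
Record ideal_space := IdealSpace {
  ideal_carrier :> {pred L0};
  ideal_norm : L0 -> R;
  ideal_submod : submod_closed ideal_carrier;
  ideal_normD : {in ideal_carrier &, forall f g,
    ideal_norm (f + g) <= ideal_norm f + ideal_norm g};
  ideal_normZ : forall a, {in ideal_carrier, forall f,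
    ideal_norm (a *: f) = `|a| * ideal_norm f};
  ideal_norm_eq0 : {in ideal_carrier, forall f, ideal_norm f = 0 -> f = 0};
  idealP : forall f g : L0, g \in ideal_carrier ->
    (\forall x \ae mu, `|f x| <= `|g x|) ->
    f \in ideal_carrier /\ ideal_norm f <= ideal_norm g }.

HB.instance Definition _ (X : ideal_space) :=
  GRing.isSubmodClosed.Build R L0 (ideal_carrier X) (ideal_submod X).

Definition ideal_type (X : ideal_space) : Type := {f : L0 | f \in ideal_carrier X}.
Definition ideal_val (X : ideal_space) (f : ideal_type X) : L0 := sval f.
Coercion ideal_val : ideal_type >-> L0.

Section normed.
Variable X : ideal_space.
HB.instance Definition _ := [isSub for @ideal_val X].
HB.instance Definition _ := [Choice of ideal_type X by <:].
HB.instance Definition _ := [SubChoice_isSubLmodule of ideal_type X by <:].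

Let nm (f : ideal_type X) := ideal_norm X f.
Let nmD (f g : ideal_type X) : nm (f + g) <= nm f + nm g.
Proof. exact: (ideal_normD (valP f) (valP g)). Qed.
Let nmZ a (f : ideal_type X) : nm (a *: f) = `|a| * nm f.
Proof. exact: (ideal_normZ a (valP f)). Qed.
Let nm0 (f : ideal_type X) : nm f = 0 -> f = 0.
Proof. by move=> /(ideal_norm_eq0 (valP f)) f0; apply/val_inj. Qed.
HB.instance Definition _ := Lmodule_isNormed.Build R (ideal_type X) nmD nmZ nm0.
End normed.

Record banach_function_space := BanachFunctionSpace {
  bfs_ideal :> ideal_space;
  bfs_complete : forall F : set_system (ideal_type bfs_ideal),
    ProperFilter F -> cauchy F -> cvg F;
  bfs_gt0 : exists2 w : L0, w \in ideal_carrier bfs_ideal &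
    \forall x \ae mu, 0 < w x }.

End ideal_space.

Section L1.
Context d (T : measurableType d) (R : realType).
Variable mu : {measure set T -> \bar R}.
Local Notation L0 := (L0 mu).

Definition L1_carrier : {pred L0} := [pred f : L0 | `[< finite_norm mu 1 f >]].
Definition L1_norm (f : L0) : R := fine ('N[mu]_1[EFin \o f])%E.

Let mE (f : L0) : measurable_fun setT (EFin \o f).
Proof. by apply/measurable_EFinP; exact: measurable_funPT. Qed.

Let NE (f : L0) : ('N[mu]_1[EFin \o f] = \int[mu]_x `|f x|%:E)%E.
Proof. by rewrite Lnorm1. Qed.

Let N_fin (f : L0) : f \in L1_carrier -> ('N[mu]_1[EFin \o f] \is a fin_num)%E.
Proof.
by move=> /asboolP ff; rewrite ge0_fin_numE ?Lnorm_ge0.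
Qed.

Let N_le (f : L0) (h : T -> \bar R) : measurable_fun setT h ->
  (\forall x \ae mu, `|f x|%:E <= h x)%E -> (forall x, 0 <= h x)%E ->
  ('N[mu]_1[EFin \o f] <= \int[mu]_x h x)%E.
Proof.
move=> mh fh h0; rewrite NE; apply: ae_ge0_le_integral => //.
- by apply: measurableT_comp => //; exact: measurableT_comp.
- by apply: filterS fh => x + _.
Qed.

Let le_fine (f : L0) (e : \bar R) : ('N[mu]_1[EFin \o f] <= e)%E -> e \is a fin_num ->
  f \in L1_carrier /\ L1_norm f <= fine e.
Proof.
move=> fe efin; have fL : f \in L1_carrier.
  by apply/asboolP; rewrite /finite_norm (le_lt_trans fe)// ltey_eq efin.
by split => //; rewrite /L1_norm fine_le// N_fin.
Qed.

Let L1D (f g : L0) : f \in L1_carrier -> g \in L1_carrier ->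
  f + g \in L1_carrier /\ L1_norm (f + g) <= L1_norm f + L1_norm g.
Proof.
move=> fL gL; rewrite -fineD ?N_fin//; apply: le_fine; last first.
  by rewrite fin_numD !N_fin.
rewrite (NE f) (NE g) -ge0_integralD//; last 2 first.
- by apply: measurableT_comp => //; exact: measurableT_comp.
- by apply: measurableT_comp => //; exact: measurableT_comp.
apply: N_le => //.
- by apply: emeasurable_funD; apply: measurableT_comp => //; exact: measurableT_comp.
- by apply: filterS (L0_addE f g) => x /(_ I) ->; rewrite -EFinD lee_fin ler_normD.
- by move=> x; rewrite adde_ge0.
Qed.

Let NZ a (f : L0) : ('N[mu]_1[EFin \o (a *: f : L0)] = `|a|%:E * 'N[mu]_1[EFin \o f])%E.
Proof.
rewrite !NE -ge0_integralZl//; last first.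
  by apply: measurableT_comp => //; exact: measurableT_comp.
apply: ae_eq_integral => //.
- by apply: measurableT_comp => //; exact: measurableT_comp.
- by apply: emeasurable_funM => //; apply: measurableT_comp => //; exact: measurableT_comp.
- by apply: filterS (L0_scaleE a f) => x /(_ I) -> _; rewrite -EFinM -normrM.
Qed.

Let L1Z a (f : L0) : f \in L1_carrier -> a *: f \in L1_carrier.
Proof.
move=> fL; have [] := @le_fine (a *: f) (`|a|%:E * 'N[mu]_1[EFin \o f])%E => //.
  by rewrite NZ.
by rewrite fin_numM// N_fin.
Qed.

Let L1_submod : submod_closed L1_carrier.
Proof.
split=> [|a f g fL gL]; last by have [] := L1D (L1Z a fL) gL.
apply/asboolP; rewrite /finite_norm NE.
rewrite (ae_eq_integral (cst 0)%E)//; first by rewrite integral0.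
- by apply: measurableT_comp => //; exact: measurableT_comp.
- by apply: filterS (L0_zeroE mu) => x /(_ I) -> _; rewrite normr0.
Qed.

Let L1_eq0 : {in L1_carrier, forall f, L1_norm f = 0 -> f = 0}.
Proof.
move=> f fL f0; have {}f0 : (\int[mu]_x `|f x|%:E = 0)%E.
  by rewrite -NE -[LHS]fineK ?N_fin//; exact: (congr1 EFin f0).
apply/L0_eqP; move: f0.
rewrite (_ : (fun x => _) = abse \o (EFin \o f))// => f0.
have [/(_ f0) h _] := ae_eq_integral_abs mu measurableT (mE f).
apply: filterS2 h (L0_zeroE mu) => x /(_ I) + /(_ I) + _.
by move=> [->] ->.
Qed.

Let L1_ideal (f g : L0) : g \in L1_carrier ->
    (\forall x \ae mu, `|f x| <= `|g x|) ->
    f \in L1_carrier /\ L1_norm f <= L1_norm g.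
Proof.
move=> gL fg; apply: le_fine; last exact: N_fin.
rewrite [leRHS]NE; apply: N_le => //.
by apply: measurableT_comp => //; exact: measurableT_comp.
Qed.

Let L1_normD :
  {in L1_carrier &, forall f g : L0, L1_norm (f + g) <= L1_norm f + L1_norm g}.
Proof. by move=> f g fL gL; have [] := L1D fL gL. Qed.

Let L1_normZ a :
  {in L1_carrier, forall f : L0, L1_norm (a *: f) = `|a| * L1_norm f}.
Proof. by move=> f fL; rewrite /L1_norm NZ fineM// N_fin. Qed.

Definition L1_space : ideal_space mu :=
  IdealSpace L1_submod L1_normD L1_normZ L1_eq0 L1_ideal.

End L1.

Section weighted_integral.
Context d (T : measurableType d) (R : realType) (mu : {measure set T -> \bar R}).
Variables (D : set T) (mD : measurable D) (w : T -> R).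
Hypotheses (mw : measurable_fun setT w) (w0 : forall t, D t -> 0 <= w t).
Implicit Types f g h : {mfun T >-> R}.
Local Notation W f := (\int[mu]_(t in D) (`|f t| * w t)%:E)%E.

Lemma wint_measurable E f : measurable_fun E (fun t => (`|f t| * w t)%:E).
Proof.
apply: (@measurable_funS _ _ _ _ setT) => //.
apply/measurable_EFinP/measurable_funM; last exact: mw.
exact: measurableT_comp.
Qed.

Let fw0 f t : D t -> (0 <= (`|f t| * w t)%:E)%E.
Proof. by move=> Dt; rewrite lee_fin mulr_ge0//; exact: w0. Qed.

Lemma wint_ge0 f : (0 <= W f)%E.
Proof. by apply: integral_ge0 => t; exact: fw0. Qed.

Lemma wint_le f g :
  (\forall t \ae mu, D t -> `|f t| <= `|g t|) -> (W f <= W g)%E.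
Proof.
move=> fh; apply: ae_ge0_le_integral.
- exact: mD.
- by move=> t; exact: fw0.
- exact: wint_measurable.
- by move=> t; exact: fw0.
- exact: wint_measurable.
- apply: filterS fh => t fh Dt; rewrite lee_fin; apply: ler_wpM2r; last exact: fh.
  exact: w0.
Qed.

Lemma wintD f g h :
  (\forall t \ae mu, D t -> `|f t| <= `|g t| + `|h t|) -> (W f <= W g + W h)%E.
Proof.
move=> fgh; rewrite -ge0_integralD; first last.
- exact: wint_measurable.
- by move=> t; exact: fw0.
- exact: wint_measurable.
- by move=> t; exact: fw0.
- exact: mD.
apply: ae_ge0_le_integral.
- exact: mD.
- by move=> t; exact: fw0.
- exact: wint_measurable.
- by move=> t Dt; apply: adde_ge0; exact: fw0.
- by apply: emeasurable_funD; exact: wint_measurable.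
- apply: filterS fgh => t fgh Dt.
  rewrite -EFinD lee_fin -mulrDl; apply: ler_wpM2r; last exact: fgh.
  exact: w0.
Qed.

Lemma wintZ a f h :
  (\forall t \ae mu, D t -> f t = a * h t) -> W f = (`|a|%:E * W h)%E.
Proof.
move=> fh; rewrite -ge0_integralZl_EFin; first last.
- exact: normr_ge0.
- exact: wint_measurable.
- by move=> t; exact: fw0.
- exact: mD.
apply: ae_eq_integral.
- exact: mD.
- exact: wint_measurable.
- apply: emeasurable_funM; last exact: wint_measurable.
  exact: measurable_cst.
- by apply: filterS fh => t fh Dt; rewrite fh// normrM -EFinM mulrA.
Qed.

Lemma wint_eq0 f : (forall t, D t -> w t != 0) -> W f = 0%E ->
  \forall t \ae mu, D t -> f t = 0.
Proof.
move=> wN0 W0.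
have [+ _] := @ae_eq_integral_abs _ _ _ mu D mD _ (@wint_measurable D f).
move=> /(_ _)/wrap[].
  rewrite -[RHS]W0; apply: eq_integral => t /[1!inE] Dt.
  by rewrite gee0_abs// fw0.
apply: filterS => t h Dt; move: (h Dt) => [] /eqP.
by rewrite mulf_eq0 normr_eq0 (negbTE (wN0 _ Dt)) orbF => /eqP.
Qed.

End weighted_integral.

Lemma ae_lebI (R : realType) (J : base_interval) (P : set (lebT R)) :
  (\forall x \ae lebI J, P x) <-> (\forall x \ae leb, base_set J x -> P x).
Proof.
have mJ := @measurable_base_set R J.
split => -[A [mA A0 PA]].
  exists (A `&` base_set J); split => //; first exact: measurableI.
  by move=> x /= /not_implyP[Jx nPx]; split => //; exact: PA.
exists (A `|` ~` base_set J); split.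
- by apply: measurableU => //; exact: measurableC.
- rewrite /lebI/= /mrestr setIUl setICl setU0; apply/eqP.
  by rewrite -measure_le0 -A0 le_measure ?inE//; exact: measurableI.
- move=> x /= nPx; have [Jx|] := pselect (base_set J x); last by right.
  by left; apply: PA => /= /(_ Jx).
Qed.

#[global] Instance lebI_ae_filter (R : realType) (J : base_interval) :
  Filter (almost_everywhere (@lebI R J)).
Proof. exact: ae_filter_ringOfSetsType. Qed.

Lemma base_set_ge0 (R : realType) (J : base_interval) (x : lebT R) :
  base_set J x -> 0 <= (x : R).
Proof. by case: J; rewrite /= in_itv/= => /andP[]. Qed.

Lemma measurable_lebT (R : realType) (f : R -> R) :
  measurable_fun setT f -> measurable_fun [set: lebT R] (f : lebT R -> R).
Proof. by move=> mf _ B mB; apply: sub_caratheodory; exact: mf. Qed.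

Lemma measurable_inv (R : realType) : measurable_fun setT (fun x : R => x^-1).
Proof.
rewrite -(setUv [set (0 : R)]); apply/measurable_funU => //.
  exact: measurableC.
split; first exact: measurable_fun_set1.
apply: open_continuous_measurable_fun; first exact/closed_openC/closed_eq.
by move=> x; rewrite inE => /eqP x0; exact: inv_continuous.
Qed.

Section Copson.
Context (R : realType) (J : base_interval).
Local Notation mu := (lebI J : {measure set (lebT R) -> \bar R}).

Definition copson (f : lebT R -> R) (x : R) : \bar R :=
  (\int[leb]_(t in base_set J `&` `[x, +oo[) (f t / (t : R))%:E)%E.

Local Notation C f := (copson (fun t => `|f t|%R)).

Section copson_lemmas.
Implicit Types (f g : {mfun lebT R >-> R}) (x : R).

Let mD x : measurable (base_set J `&` `[x, +oo[ : set (lebT R)).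
Proof. by apply: measurableI; [exact: measurable_base_set|exact: measurable_lebT_itv]. Qed.

Let mV : measurable_fun [set: lebT R] (fun t : lebT R => (t : R)^-1).
Proof. by apply: measurable_lebT; exact: measurable_inv. Qed.

Let V0 x (t : lebT R) : (base_set J `&` `[x, +oo[) t -> 0 <= (t : R)^-1.
Proof. by move=> [Jt _]; rewrite invr_ge0; exact: base_set_ge0 Jt. Qed.

Let ae_mD x (P : set (lebT R)) : (\forall t \ae mu, P t) ->
  \forall t \ae leb, (base_set J `&` `[x, +oo[) t -> P t.
Proof. by move=> /ae_lebI; apply: filterS => t + [Jt _]; exact. Qed.

Lemma copson_ge0 f x : (0 <= C f x)%E.
Proof. exact: (@wint_ge0 _ _ R leb _ _ (@V0 x) f). Qed.

Lemma copson_le f (h : {mfun lebT R >-> R}) x :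
  (\forall t \ae mu, `|f t| <= `|h t|) -> (C f x <= C h x)%E.
Proof. by move=> /(ae_mD x); exact: (@wint_le _ _ R leb _ (mD x) _ mV (@V0 x) f h). Qed.

Lemma copsonD f (g h : {mfun lebT R >-> R}) x :
  (\forall t \ae mu, `|f t| <= `|g t| + `|h t|) -> (C f x <= C g x + C h x)%E.
Proof. by move=> /(ae_mD x); exact: (@wintD _ _ R leb _ (mD x) _ mV (@V0 x) f g h). Qed.

Lemma copsonZ a f (h : {mfun lebT R >-> R}) x :
  (\forall t \ae mu, f t = a * h t) -> C f x = (`|a|%:E * C h x)%E.
Proof. by move=> /(ae_mD x); exact: (@wintZ _ _ R leb _ (mD x) _ mV (@V0 x) a f h). Qed.

Lemma copson_eq0 f x : 0 < x -> C f x = 0%E ->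
  \forall t \ae leb, (base_set J `&` `[x, +oo[) t -> f t = 0.
Proof.
move=> x0; apply: (@wint_eq0 _ _ R leb _ (mD x) _ mV (@V0 x) f) => t [_].
rewrite /= in_itv/= andbT => xt; apply: invr_neq0.
by rewrite gt_eqF// (lt_le_trans x0).
Qed.

Lemma copson_noninc f x y : x <= y -> (C f y <= C f x)%E.
Proof.
move=> xy; apply: ge0_subset_integral.
- exact: mD.
- exact: mD.
- exact: (wint_measurable mV).
- by move=> t Dt; rewrite lee_fin; apply: mulr_ge0 => //; exact: V0 Dt.
apply: setIS => t /=; rewrite !in_itv/= !andbT; exact: le_trans.
Qed.

Lemma measurable_copson f : measurable_fun [set: lebT R] (C f).
Proof.
apply: (measurability (@ErealGenCInfty.G R)) => [|/= _ [_ [y ->] <-]].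
  exact: ErealGenCInfty.measurableE.
rewrite setTI; apply: sub_caratheodory; apply: is_interval_measurable.
move=> s t /=; rewrite !in_itv/= !andbT => _ yt u /andP[_ ut].
by rewrite in_itv/= andbT (le_trans yt)// copson_noninc.
Qed.

End copson_lemmas.

Variable X : ideal_space mu.
Local Notation L0 := (L0 mu).

(* copson_rel f g holds when C*|f| is finite a.e. on I and g is its class; such
   a g is unique. *)
Definition copson_rel (f g : L0) : Prop :=
  \forall x \ae mu, (g x)%:E = copson (fun t => `|f t|) x.

Definition copson_carrier : {pred L0} :=
  [pred f : L0 | `[< exists2 g : L0, g \in X & copson_rel f g >]].

Definition copson_norm (f : L0) : R := ideal_norm X (xget 0 (copson_rel f)).

Let normE (f g : L0) : copson_rel f g -> copson_norm f = ideal_norm X g.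
Proof.
move=> fg; congr (ideal_norm X _); apply/L0_eqP.
have fg' : copson_rel f (xget 0 (copson_rel f)) by apply: (@xgetPex _ 0 (copson_rel f)); exists g.
by apply: filterS2 fg fg' => x e1 e2 _; apply: EFin_inj; rewrite e2 e1.
Qed.

Let carrierP (f : L0) : f \in copson_carrier <-> exists2 g : L0, g \in X & copson_rel f g.
Proof. by split => /asboolP. Qed.

Let fine_mfun (f : L0) : isMeasurableFun _ _ (lebT R) R
  (fine \o C f).
Proof.
constructor; apply: measurableT_comp; first exact: fine_measurable.
exact: measurable_copson.
Qed.

Let ex_rel (f h : L0) : h \in X ->
    (\forall x \ae mu, (C f x <= `|h x|%:E)%E) ->
  exists g : L0, [/\ copson_rel f g, g \in X & ideal_norm X g <= ideal_norm X h].
Proof.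
move=> hX fh.
pose gf : {mfun lebT R >-> R} :=
  HB.pack (fine \o C f) (fine_mfun f).
pose g : L0 := L0_class mu gf.
have gE : copson_rel f g.
  apply: filterS2 fh (L0_classE mu gf) => x fhx /(_ I) ->.
  rewrite /= fineK// ge0_fin_numE; last exact: copson_ge0.
  by rewrite (le_lt_trans fhx)// ltry.
have [] := @idealP _ _ _ _ X g h hX.
  apply: filterS2 fh gE => x fhx gx; rewrite -lee_fin.
  by rewrite -[(`|g x|)%:E]/(`|(g x)%:E|)%E gx gee0_abs//; exact: copson_ge0.
by exists g.
Qed.

Let dominated (f h : L0) : h \in X ->
    (\forall x \ae mu, (C f x <= `|h x|%:E)%E) ->
  f \in copson_carrier /\ copson_norm f <= ideal_norm X h.
Proof.
move=> hX /(ex_rel hX)[g [fg gX gh]]; rewrite (normE fg); split => //.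
by apply/carrierP; exists g.
Qed.

Let copson_ideal (f g : L0) : g \in copson_carrier ->
    (\forall x \ae mu, `|f x| <= `|g x|) ->
  f \in copson_carrier /\ copson_norm f <= copson_norm g.
Proof.
move=> /carrierP[h hX gh] fg; rewrite (normE gh); apply: dominated => //.
apply: filterS gh => x gh; apply: le_trans (copson_le x fg) _.
by rewrite -gh lee_fin ler_norm.
Qed.

Let copsonD_space (f g : L0) : f \in copson_carrier -> g \in copson_carrier ->
  f + g \in copson_carrier /\ copson_norm (f + g) <= copson_norm f + copson_norm g.
Proof.
move=> /carrierP[h hX fh] /carrierP[k kX gk]; rewrite (normE fh) (normE gk).
have [|fgC fgN] := @dominated (f + g) (h + k) (rpredD hX kX).
  apply: filterS3 fh gk (L0_addE h k) => x fh gk /(_ I) ->.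
  have fg : \forall t \ae mu, `|(f + g : L0) t| <= `|f t| + `|g t|.
    by apply: filterS (L0_addE f g) => t /(_ I) ->; exact: ler_normD.
  apply: le_trans (copsonD x fg) _.
  by rewrite -fh -gk -EFinD lee_fin ler_norm.
by split => //; apply: le_trans fgN _; exact: ideal_normD.
Qed.

Let copsonZ_space a (f : L0) : f \in copson_carrier ->
  a *: f \in copson_carrier /\ copson_norm (a *: f) = `|a| * copson_norm f.
Proof.
move=> /carrierP[h hX fh].
have afh : copson_rel (a *: f) (`|a| *: h).
  apply: filterS2 fh (L0_scaleE `|a| h) => x fh /(_ I) ->.
  rewrite (@copsonZ a _ f); first by rewrite -fh.
  by apply: filterS (L0_scaleE a f) => t /(_ I).
split; first by apply/carrierP; exists (`|a| *: h) => //; exact: rpredZ.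
by rewrite (normE afh) (normE fh) ideal_normZ// normr_id.
Qed.

Let copson_submod : submod_closed copson_carrier.
Proof.
split; last first.
  by move=> a f g fC gC; have [] := copsonD_space (copsonZ_space a fC).1 gC.
have [|//] := @dominated 0 0 (rpred0 _).
apply: filterS (L0_zeroE mu) => x _.
rewrite (@copsonZ 0 _ 0); first by rewrite normr0 mul0e lee_fin.
by apply: filterS (L0_zeroE mu) => t /(_ I) ->; rewrite mul0r.
Qed.

Let copson_normD :
  {in copson_carrier &, forall f g : L0, copson_norm (f + g) <= copson_norm f + copson_norm g}.
Proof. by move=> f g fC gC; have [] := copsonD_space fC gC. Qed.

Let copson_normZ a :
  {in copson_carrier, forall f : L0, copson_norm (a *: f) = `|a| * copson_norm f}.
Proof. by move=> f fC; have [] := copsonZ_space a fC. Qed.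

Let lebI_near0 (e : R) : 0 < e -> (0 < mu [set` `]0%R, e[%R])%E.
Proof.
move=> e0; pose m := Num.min e 1; have m0 : 0 < m by rewrite lt_min e0 ltr01.
have lm : (0 < leb ([set` `]0%R, m[%R] : set (lebT R)))%E.
  have -> : leb ([set` `]0%R, m[%R] : set (lebT R)) =
      lebesgue_measure [set` `]0%R, m[%R] by [].
  by rewrite lebesgue_measure_itv/= lte_fin m0 oppr0 adde0 lte_fin.
suff : (leb ([set` `]0%R, m[%R] : set (lebT R)) <=
    leb ([set` `]0%R, e[%R] `&` base_set J : set (lebT R)))%E.
  exact: lt_le_trans.
apply: le_measure; rewrite ?inE.
- exact: measurable_lebT_itv.
- by apply: measurableI; [exact: measurable_lebT_itv|exact: measurable_base_set].
- move=> t; rewrite /= in_itv/= lt_min => /and3P[t0 te t1].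
  split; first by rewrite /= in_itv/= t0.
  by case: J; rewrite /= in_itv/= ltW//= ltW.
Qed.

Let copson_norm_eq0 :
  {in copson_carrier, forall f : L0, copson_norm f = 0 -> f = 0}.
Proof.
move=> f /carrierP[g gX fg]; rewrite (normE fg) => /(ideal_norm_eq0 gX) g0.
have C0 : \forall x \ae mu, C f x = 0%E.
  by apply: filterS2 fg (L0_zeroE mu) => x <- /(_ I); rewrite g0 => ->.
have small n : exists2 x : R, 0 < x < n.+1%:R^-1 & C f x = 0%E.
  apply: contrapT => nx; have [A [mA A0 CA]] := C0.
  have : (0 < mu [set` `]0%R, (n.+1%:R^-1)%R[%R])%E by apply: lebI_near0; rewrite invr_gt0.
  apply/negP; rewrite -leNgt -A0; apply: le_measure; rewrite ?inE//.
    exact: measurable_lebT_itv.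
  move=> x; rewrite /= in_itv/= => xn; apply: CA => /= Cx; apply: nx.
  by exists x.
have f0 : \forall t \ae leb, forall n, base_set J t -> n.+1%:R^-1 <= (t : R) -> f t = 0.
  apply: ae_foralln => n; have [x /andP[x0 xn] Cx] := small n.
  apply: filterS (copson_eq0 x0 Cx) => t ft Jt nt; apply: ft; split => //.
  by rewrite /= in_itv/= andbT (le_trans (ltW xn)).
have N0 : \forall t \ae leb, (t : R) != 0.
  exists [set (0 : R)]; split.
  - by have := @measurable_lebT_itv R `[0, 0]; rewrite set_itv1.
  - have -> : leb ([set (0 : R)] : set (lebT R)) = lebesgue_measure [set (0 : R)] by [].
    by rewrite lebesgue_measure_set1.
  - by move=> t /= /negP; rewrite negbK => /eqP.
have : \forall t \ae mu, f t = 0.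
  apply/ae_lebI; apply: filterS2 f0 N0 => t ft tN0 Jt.
  have t0 : 0 < (t : R) by rewrite lt_def tN0 (base_set_ge0 Jt).
  have [n nt] := @ltr_add_invr R 0 t t0.
  by apply: (ft n) => //; rewrite add0r in nt; exact: ltW.
move=> fz; apply/L0_eqP; apply: filterS2 fz (L0_zeroE mu) => t -> /(_ I) -> _.
by [].
Qed.

Definition copson_space : ideal_space mu :=
  IdealSpace copson_submod copson_normD copson_normZ copson_norm_eq0 copson_ideal.

End Copson.

Section norms_on_I.
Context (R : realType) (J : base_interval).
Local Notation mu := (lebI J : {measure set (lebT R) -> \bar R}).

Definition chi (i : interval R) : L0 mu :=
  L0_class mu (mindic R (measurable_lebT_itv i)).

(* The point t = 0, where t^-1 = 0 by convention, is negligible. *)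
Definition L1_inv_norm (f : L0 mu) : \bar R :=
  (\int[leb]_(t in base_set J) (`|f t| / (t : R))%:E)%E.

(* As f is an equivalence class, its support is only defined up to a
   negligible set. *)
Definition supp_in (f : L0 mu) (i : interval R) : Prop :=
  \forall x \ae mu, f x != 0 -> (x : R) \in i.

End norms_on_I.

Section complemented.
Context (R : realType) (E F : normedModType R).

Definition complemented_subspace (Y : set F) : Prop :=
  closed Y /\ exists P : {linear F -> F},
    [/\ continuous P, forall v, P (P v) = P v & range P = Y].

Definition isomorphic_to_subspace (Y : set F) : Prop :=
  exists T : {linear E -> F}, [/\ continuous T,
    exists2 c : R, 0 < c & forall u, c * `|u| <= `|T u| & range T = Y].

Definition contains_complemented_copy : Prop :=
  exists Y : set F, complemented_subspace Y /\ isomorphic_to_subspace Y.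

End complemented.

(* Main.v *)
Require Import Defs.
From HB Require Import structures.
From mathcomp Require Import all_boot all_order all_algebra.
From mathcomp Require Import all_classical all_reals all_analysis.
From mathcomp Require Import measurable_realfun ring.
Import Order.TTheory GRing.Theory Num.Theory.
Import numFieldNormedType.Exports.
Local Open Scope classical_set_scope.
Local Open Scope ring_scope.
Set Implicit Arguments.
Unset Strict Implicit.
Unset Printing Implicit Defensive.

(** Write [C f] for the Copson transform of [|f|], which is nonincreasing, and
    [W] for the norm of [f] in L1(1/t).  If [f] vanishes off [[a, b]], then every
    [x <= a] sees the whole support of [f] and every [x > b] sees none of it, so
    that [W chi_[0,a] <= C f <= W chi_[0,b]] on [I].  Taking norms in [X] gives
    both inequalities ([copson_norm_ge], [copson_norm_le]), provided that the two
    indicators lie in [X].  A nonzero [f] in the Copson space supplies them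
    ([exists_chi]): [C f] cannot vanish on all of ]0, 1[, so it is at least some
    [d > 0] at some [b < 1], hence on all of [[0, b]] by monotonicity, and
    [d chi_[0,b] <= C f] puts [chi_[0,b]] in [X] by the ideal property.  Any [a]
    in ]0, b[ then works; [a = b / 2] is chosen.

    For the complemented copy, cutting a function off outside [[a, b]] is a
    projection of norm at most 1 by the ideal property, and its range carries a
    norm equivalent to that of L1(1/t) on [[a, b]].  With [phi] the increasing
    affine bijection of [[a, b]] onto [[0, 1]], the map
    [u |-> t * u (phi t)] is, up to the factor [b - a], an isometry of L1[0, 1]
    onto L1(1/t) on [[a, b]] ([L1_inv_norm_spread]), with inverse
    [f |-> f (psi x) / psi x] for [psi] the inverse of [phi] ([gather_opK]).
    This yields [copson_contains_L1].

    These maps compose classes of Lebesgue (not only Borel) measurable functions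
    with affine maps, which requires that affine maps pull Lebesgue measurable
    sets back to Lebesgue measurable sets and null sets to null sets.  Both
    follow from the scaling of the outer measure ([outer_affine]), since
    measurability in the sense of Caratheodory refers to nothing else. *)

(** * Affine changes of variables for Lebesgue measure *)

Section affine.
Variable R : realType.
Local Notation hlength := (@wlength R idfun).
Local Notation lambda := (@leb R).

Definition affine (c s : R) (x : lebT R) : lebT R := (c + s * x : R).

Lemma affineK (c s : R) : s != 0 ->
  cancel (affine c s) (affine (- (c / s)) s^-1).
Proof. by move=> s0 x; rewrite /affine; field. Qed.

Lemma affineVK (c s : R) : s != 0 ->
  cancel (affine (- (c / s)) s^-1) (affine c s).
Proof. by move=> s0 x; rewrite /affine; field. Qed.

Lemma affine_preimageK (c s : R) (A : set (lebT R)) : s != 0 ->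
  affine (- (c / s)) s^-1 @^-1` (affine c s @^-1` A) = A.
Proof. by move=> s0; apply/seteqP; split=> x /=; rewrite affineVK. Qed.

Lemma affine_preimage_ocitv (c s x y : R) : 0 < s ->
  affine c s @^-1` `]x, y]%classic = `](x - c) / s, (y - c) / s]%classic.
Proof.
move=> s0; apply/seteqP; split=> t /=; rewrite !in_itv/= /affine;
by rewrite ltr_pdivrMr// ler_pdivlMr// ltrBlDl lerBrDl mulrC.
Qed.

Lemma hlength_affine (c s : R) (A : set (ocitv_type R)) : 0 < s ->
  ocitv A -> ocitv (affine c s @^-1` A) /\
  hlength A = (s%:E * hlength (affine c s @^-1` A))%E.
Proof.
move=> s0 [[x y] _ <-] /=; rewrite affine_preimage_ocitv//.
split; first exact: is_ocitv.
rewrite !wlength_itv/= !lte_fin ltr_pM2r ?invr_gt0// ltrD2r.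
case: ifPn => _; last by rewrite mule0.
by rewrite -!EFinD -EFinM/=; congr (_%:E); field; rewrite gt_eqF.
Qed.

Local Notation outer := (hlength^*)%mu.

(** The preimages of a cover by half-open intervals are such a cover of the
    preimage, with lengths divided by [s]. *)
Lemma outer_affine_le (c s : R) (A : set R) : 0 < s ->
  (s%:E * outer (affine c s @^-1` A) <= outer A)%E.
Proof.
move=> s0; apply: le_ereal_inf_tmp => _ [F [mF AF] <-].
have -> : (\sum_(k <oo) hlength (F k) =
    s%:E * \sum_(k <oo) hlength (affine c s @^-1` F k))%E.
  rewrite -nneseriesZl; last by move=> i _; exact: wlength_ge0.
  apply: eq_eseriesr => i _.
  by have [_] := hlength_affine c s0 (mF i).
rewrite lee_pmul2l ?lte_fin//; apply: ereal_inf_lbound.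
exists (fun k => affine c s @^-1` F k) => //; split.
  by move=> i; have [] := hlength_affine c s0 (mF i).
by move=> x /= /AF[k _ Fk]; exists k.
Qed.

(** The reverse inequality is [outer_affine_le] for the inverse affine map. *)
Lemma outer_affine (c s : R) (A : set R) : 0 < s ->
  (outer A = s%:E * outer (affine c s @^-1` A))%E.
Proof.
move=> s0; have sN0 : s != 0 by rewrite gt_eqF.
apply/eqP; rewrite eq_le outer_affine_le// andbT.
have si : 0 < s^-1 by rewrite invr_gt0.
have := outer_affine_le (- (c / s)) (affine c s @^-1` A) si.
rewrite affine_preimageK// -(@lee_pmul2l _ s%:E)//.
  by rewrite muleA -EFinM mulfV// mul1e.
Qed.

(** A test set [Y] for the preimage of [B] is the preimage of a test set for
    [B], and the outer measures of all the sets involved differ by the same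
    factor. *)
Lemma measurable_affine (c s : R) : 0 < s ->
  measurable_fun setT (affine c s : lebT R -> lebT R).
Proof.
move=> s0 _ B mB; rewrite setTI.
have {}mB : caratheodory_measurable outer B by exact: mB.
suff : caratheodory_measurable outer (affine c s @^-1` B) by [].
move=> Y.
have sN0 : s != 0 by rewrite gt_eqF.
have E (Z : set R) :
    outer Z = (s^-1%:E * outer (affine (- (c / s)) s^-1 @^-1` Z))%E.
  by apply: outer_affine; rewrite invr_gt0.
rewrite E (E (_ `&` _)) (E (_ `&` ~` _)) !preimage_setI.
rewrite -ge0_muleDr ?mu_ext_ge0//.
rewrite preimage_setC !affine_preimageK//.
by congr (_ * _)%E; exact: mB.
Qed.

Lemma leb_affine (c s : R) (A : set (lebT R)) : 0 < s ->
  (lambda (affine c s @^-1` A) = s^-1%:E * lambda A)%E.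
Proof.
move=> s0; have sN0 : s != 0 by rewrite gt_eqF.
rewrite [X in (_ = _ * X)%E](outer_affine c A s0) muleA -EFinM mulVf//.
by rewrite mul1e.
Qed.

Lemma ge0_integral_affine (c s : R) (D : set (lebT R)) (h : lebT R -> \bar R) :
  0 < s -> measurable D -> measurable_fun D h -> (forall x, D x -> 0 <= h x)%E ->
  (\int[lambda]_(t in affine c s @^-1` D) h (affine c s t) =
   s^-1%:E * \int[lambda]_(x in D) h x)%E.
Proof.
move=> s0 mD mh h0; have ma := @measurable_affine c s s0.
rewrite -(@ge0_integral_pushforward _ _ _ _ R _ ma lambda D h)//; last first.
  by move=> x; rewrite inE; exact: h0.
have sinv : 0 <= s^-1 by rewrite invr_ge0 ltW.
rewrite -(@ge0_integral_mscale _ _ R lambda D mD (NngNum sinv) h)//.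
apply: eq_measure_integral => A mA _ /=.
by rewrite /pushforward leb_affine.
Qed.

Lemma ae_affine (c s : R) (P : set (lebT R)) : 0 < s ->
  (\forall x \ae lambda, P x) -> \forall t \ae lambda, P (affine c s t).
Proof.
move=> s0 [N [mN N0 PN]]; exists (affine c s @^-1` N); split.
- by rewrite -[X in measurable X]setTI; exact: measurable_affine.
- by rewrite leb_affine// N0 mule0.
- by move=> t /= nP; exact: PN.
Qed.

End affine.
(** * Weighted composition operators *)

Section weighted_composition.
Context d1 d2 (T1 : measurableType d1) (T2 : measurableType d2) (R : realType).
Variables (mu1 : {measure set T1 -> \bar R}) (mu2 : {measure set T2 -> \bar R}).
Variables (w : {mfun T1 >-> R}) (phi : {mfun T1 >-> T2}).

Definition wcomp (u : L0 mu2) : L0 mu1 :=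
  L0_class mu1 (w * ((u : {mfun T2 >-> R}) \o phi : {mfun T1 >-> R})).

Lemma wcompE (u : L0 mu2) : \forall t \ae mu1, wcomp u t = w t * u (phi t).
Proof.
have := L0_classE mu1 (w * ((u : {mfun T2 >-> R}) \o phi : {mfun T1 >-> R})).
by apply: filterS => t /(_ I) ->.
Qed.

(** What makes [wcomp] compatible with equality almost everywhere.  Restricting
    to the points of nonzero weight lets [phi] map the others into null sets:
    the affine maps below send points outside an interval out of [I]. *)
Definition nonsingular := forall P : set T2,
  (\forall x \ae mu2, P x) -> \forall t \ae mu1, w t != 0 -> P (phi t).

Lemma wcomp_linear : nonsingular -> linear wcomp.
Proof.
move=> ns a; move: (a : R) => {}a u v; move: (u : L0 mu2) (v : L0 mu2) => {}u {}v.
apply/L0_eqP.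
have uv : \forall x \ae mu2, (a *: u + v : L0 mu2) x = a * u x + v x.
  by apply: filterS2 (L0_addE (a *: u) v) (L0_scaleE a u) => x /(_ I) -> /(_ I)/= ->.
apply: filterS2 (filterI (wcompE (a *: u + v)) (ns _ uv))
  (filterI (filterI (L0_addE (a *: wcomp u) (wcomp v)) (L0_scaleE a (wcomp u)))
           (filterI (wcompE u) (wcompE v))) => t.
move=> [-> uvt] [[/(_ I) -> /(_ I)/= ->] [-> ->]] _.
have [->|/uvt ->] := eqVneq (w t) 0; first by rewrite !mul0r scaler0 addr0.
by rewrite mulrDr mulrCA.
Qed.

End weighted_composition.

(** * Bounded operators and projections *)

Lemma ideal_norm_ge0 d (T : measurableType d) (R : realType)
    (mu : {measure set T -> \bar R}) (X : ideal_space mu) (f : L0 mu) :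
  f \in ideal_carrier X -> 0 <= ideal_norm X f.
Proof.
move=> fX; pose f' : ideal_type X := exist _ f fX.
by rewrite -[ideal_norm X f]/(`|f'|) normr_ge0.
Qed.

Lemma bounded_operator d1 d2 (T1 : measurableType d1) (T2 : measurableType d2)
    (R : realType) (mu1 : {measure set T1 -> \bar R})
    (mu2 : {measure set T2 -> \bar R}) (X : ideal_space mu1) (Y : ideal_space mu2)
    (A : L0 mu1 -> L0 mu2) (k : R) : linear A ->
    (forall f, f \in ideal_carrier X ->
      A f \in ideal_carrier Y /\ ideal_norm Y (A f) <= k * ideal_norm X f) ->
  exists T : {linear ideal_type X -> ideal_type Y},
    continuous T /\ forall f : ideal_type X, ideal_val (T f) = A f.
Proof.
move=> linA bdA.
pose T0 (f : ideal_type X) : ideal_type Y :=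
  exist _ (A f) (bdA (f : L0 mu1) (valP f)).1.
have linT : linear T0.
  by move=> a f g; apply/val_inj; exact: linA.
pose T : {linear ideal_type X -> ideal_type Y} :=
  HB.pack T0 (GRing.isLinear.Build _ _ _ _ T0 linT).
exists T; split=> //.
apply: bounded_linear_continuous; apply/linear_boundedP.
near=> r => f; move: (f : ideal_type X) => {}f.
have := (bdA (f : L0 mu1) (valP f)).2.
rewrite -[ideal_norm Y _]/(`|T f|) -[ideal_norm X _]/(`|f|) => /le_trans; apply.
by apply: ler_wpM2r; [exact: (normr_ge0 f)|near: r; apply: nbhs_pinfty_ge; exact: num_real].
Unshelve. all: by end_near. Qed.

Lemma range_projection (R : realType) (F : normedModType R) (P : {linear F -> F}) :
  (forall v, P (P v) = P v) -> range P = [set v | P v = v].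
Proof.
by move=> PP; apply/seteqP; split=> [_ [v _ <-]|v Pv]; [exact: PP|exists v].
Qed.

(** The range is closed, being the kernel of the continuous map [P - id]. *)
Lemma complemented_range (R : realType) (F : normedModType R) (P : {linear F -> F}) :
  continuous P -> (forall v, P (P v) = P v) -> complemented_subspace (range P).
Proof.
move=> cP PP; split; last by exists P.
rewrite range_projection//.
have -> : [set v | P v = v] = (fun v => P v - v) @^-1` [set 0].
  apply/seteqP; split=> v /= => [->|/eqP]; first by rewrite subrr.
  by rewrite subr_eq0 => /eqP.
apply: preimage_closed; first by move=> v _; apply: cvgB; [exact: cP|exact: cvg_id].
exact/accessible_closed_set1/hausdorff_accessible/norm_hausdorff.
Qed.

(** * Functions supported in an interval *)

Lemma ge0_integral_support d (T : measurableType d) (R : realType)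
    (mu : {measure set T -> \bar R}) (D E : set T) (h : T -> \bar R) :
  measurable D -> measurable E -> D `<=` E -> measurable_fun E h ->
  (forall x, E x -> 0 <= h x)%E ->
  (\forall x \ae mu, E x -> ~ D x -> h x = 0%E) ->
  (\int[mu]_(x in D) h x = \int[mu]_(x in E) h x)%E.
Proof.
move=> mD mE DE mh h0 hD.
have -> : (\int[mu]_(x in D) h x = \int[mu]_(x in E) (h \_ D) x)%E.
  by rewrite [RHS]integral_mkcond -patch_setI setIidr// -integral_mkcond.
apply: ge0_ae_eq_integral => //.
- apply/(measurable_restrict _ mD mE); apply: (measurable_funS mE _ mh).
  exact: subIsetl.
- by move=> x Ex; rewrite patchE; case: ifP => // _; exact: h0.
- apply: filterS hD => x hx Ex; rewrite patchE; case: ifPn => //.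
  by rewrite notin_setE => nDx; rewrite hx.
Qed.

Section copson_support.
Context (R : realType) (J : base_interval).
Local Notation mu := (lebI J : {measure set (lebT R) -> \bar R}).
Local Notation C f := (copson J (fun t => `|f t|%R)).
Implicit Types f g h : L0 mu.

Let V0 (t : lebT R) : base_set J t -> 0 <= (t : R)^-1.
Proof. by move=> Jt; rewrite invr_ge0; exact: base_set_ge0 Jt. Qed.

Lemma measurable_copson_integrand f (D : set (lebT R)) :
  measurable_fun D (fun t : lebT R => (`|f t| / (t : R))%:E).
Proof. by apply: wint_measurable; apply: measurable_lebT; exact: measurable_inv. Qed.

Lemma copson_integrand_ge0 f (t : lebT R) :
  base_set J t -> (0 <= (`|f t| / (t : R))%:E)%E.
Proof. by move=> Jt; rewrite lee_fin mulr_ge0// V0. Qed.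

Lemma measurable_copson_domain x :
  measurable (base_set J `&` `[x, +oo[ : set (lebT R)).
Proof. by apply: measurableI; [exact: measurable_base_set|exact: measurable_lebT_itv]. Qed.

Hint Resolve measurable_copson_integrand measurable_copson_domain : core.

Lemma L1_inv_norm_ge0 f : (0 <= L1_inv_norm f)%E.
Proof. by apply: integral_ge0 => t; exact: copson_integrand_ge0. Qed.

Lemma copson_le_L1_inv_norm f x : (C f x <= L1_inv_norm f)%E.
Proof.
apply: ge0_subset_integral => //; first exact: measurable_base_set.
by move=> t; exact: copson_integrand_ge0.
Qed.

Lemma copson_below_support f a b x : supp_in f `[a, b] -> x <= a ->
  C f x = L1_inv_norm f.
Proof.
move=> /ae_lebI fab xa; apply: ge0_integral_support => //.
- exact: measurable_base_set.
- by move=> t; exact: copson_integrand_ge0.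
- apply: filterS fab => t + Jt nD => /(_ Jt) ft.
  have [->|/ft] := eqVneq (f t) 0; first by rewrite normr0 mul0r.
  rewrite in_itv/= => /andP[at_ _]; exfalso; apply: nD; split => //=.
  by rewrite in_itv/= andbT (le_trans xa).
Qed.

Lemma copson_above_support f a b x : supp_in f `[a, b] -> b < x -> C f x = 0%E.
Proof.
move=> /ae_lebI fab bx; rewrite /copson -(@ge0_integral_support _ _ _ _ set0)//.
- by rewrite integral_set0.
- by move=> t [Jt _]; exact: copson_integrand_ge0.
- apply: filterS fab => t ft [Jt xt] _; move: ft xt => /(_ Jt) ft.
  rewrite /= in_itv/= andbT => xt.
  have [->|/ft] := eqVneq (f t) 0; first by rewrite normr0 mul0r.
  by rewrite in_itv/= => /andP[_]; rewrite leNgt (lt_le_trans bx).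
Qed.

Lemma chiE (i : interval R) : \forall x \ae mu, chi J i x = ((x : R) \in i)%:R.
Proof.
have := L0_classE mu (mindic R (measurable_lebT_itv i)).
apply: filterS => x /(_ I) ->.
by rewrite -[LHS]/((\1_[set` i] : lebT R -> R) x) indicE mem_setE.
Qed.

Lemma chi_neq0 (a : R) : 0 < a -> chi J `[0, a] != 0.
Proof.
move=> a0; apply/negP => /eqP chi0.
have : \forall x \ae mu, ((x : R) \in `[0, a]) = false.
  apply: filterS2 (chiE `[0, a]) (L0_zeroE mu) => x.
  by rewrite chi0 => -> /(_ I); case: (_ \in _) => //= /eqP; rewrite oner_eq0.
move=> /ae_lebI[N [mN N0 subN]].
(* I contains [0, 1], so [0, min a 1] lies in both I and [0, a]. *)
pose m := Num.min a 1; have m0 : 0 < m by rewrite lt_min a0 ltr01.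
have : (leb ([set` `[0%R, m]%R] : set (lebT R)) <= leb N)%E.
  apply: le_measure; rewrite ?inE//; first exact: measurable_lebT_itv.
  move=> x /=; rewrite in_itv/= le_min => /and3P[x0 xa x1]; apply: subN => /= xN.
  have := xN; rewrite in_itv/= x0 xa => /(_ _)/wrap[]//.
  by case: J; rewrite /= in_itv/= x0.
have -> : leb ([set` `[0%R, m]%R] : set (lebT R)) = lebesgue_measure [set` `[0%R, m]%R] by [].
by rewrite lebesgue_measure_itv/= lte_fin m0 N0 oppr0 adde0 lee_fin leNgt m0.
Qed.

Variable X : ideal_space mu.

Lemma copson_spaceP f : f \in ideal_carrier (copson_space X) <->
  exists2 g, g \in ideal_carrier X & copson_rel f g.
Proof. by split=> /asboolP. Qed.

Lemma copson_space_norm f g : copson_rel f g ->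
  ideal_norm (copson_space X) f = ideal_norm X g.
Proof.
move=> fg; congr (ideal_norm X _); apply/L0_eqP.
have fg' : copson_rel f (xget 0 (copson_rel f)).
  by apply: (@xgetPex _ 0 (copson_rel f)); exists g.
by apply: filterS2 fg fg' => x e1 e2 _; apply: EFin_inj; rewrite e2 e1.
Qed.

(** A bound by an element of [X] makes [C f] finite almost everywhere, hence the
    values of an element of [X] by the ideal property. *)
Lemma copson_space_dominated f h : h \in ideal_carrier X ->
    (\forall x \ae mu, (C f x <= `|h x|%:E)%E) ->
  f \in ideal_carrier (copson_space X) /\
  ideal_norm (copson_space X) f <= ideal_norm X h.
Proof.
move=> hX fh.
have mC : measurable_fun [set: lebT R] (fine \o C f).
  by apply: measurableT_comp; [exact: fine_measurable|exact: measurable_copson].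
pose g0 : {mfun lebT R >-> R} :=
  HB.pack (fine \o C f) (isMeasurableFun.Build _ _ (lebT R) R (fine \o C f) mC).
have fg : copson_rel f (L0_class mu g0).
  apply: filterS2 fh (L0_classE mu g0) => x fhx /(_ I) ->.
  rewrite /= fineK// ge0_fin_numE; last exact: copson_ge0.
  by rewrite (le_lt_trans fhx)// ltry.
have [|gX gh] := idealP (f := L0_class mu g0) hX.
  apply: filterS2 fh fg => x fhx gx; rewrite -lee_fin.
  by rewrite -[(`|_|)%:E]/(`|(L0_class mu g0 x)%:E|)%E gx gee0_abs//; exact: copson_ge0.
split; last by rewrite (copson_space_norm fg).
by apply/copson_spaceP; exists (L0_class mu g0).
Qed.

(** [C f] is constantly the L1(1/t) norm of [f] on [[0, a]], a set of positive
    measure, and is finite almost everywhere. *)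
Lemma copson_space_supp_fin f a b : 0 < a -> supp_in f `[a, b] ->
  f \in ideal_carrier (copson_space X) -> L1_inv_norm f \is a fin_num.
Proof.
move=> a0 fab /copson_spaceP[g _ fg].
rewrite ge0_fin_numE; last exact: L1_inv_norm_ge0.
rewrite ltey; apply: contra (chi_neq0 a0) => /eqP Woo; apply/eqP/L0_eqP.
apply: filterS3 fg (chiE `[0, a]) (L0_zeroE mu) => x gx -> /(_ I) -> _.
case: (boolP (_ \in _)) => //; rewrite in_itv/= => /andP[_ xa].
by move: gx; rewrite (copson_below_support fab xa) Woo.
Qed.

Lemma copson_norm_ge f a b : 0 < a -> supp_in f `[a, b] ->
  chi J `[0, a] \in ideal_carrier X -> f \in ideal_carrier (copson_space X) ->
  ideal_norm X (chi J `[0, a]) * fine (L1_inv_norm f) <=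
    ideal_norm (copson_space X) f.
Proof.
move=> a0 fab chiX fX; have Wfin := copson_space_supp_fin a0 fab fX.
have W0 : 0 <= fine (L1_inv_norm f) by rewrite fine_ge0// L1_inv_norm_ge0.
have /copson_spaceP[g gX fg] := fX; rewrite (copson_space_norm fg).
rewrite mulrC -(ger0_norm W0) -ideal_normZ//.
have [|_ //] := idealP (f := fine (L1_inv_norm f) *: chi J `[0, a]) gX.
apply: filterS3 fg (chiE `[0, a]) (L0_scaleE (fine (L1_inv_norm f)) (chi J `[0, a])).
move=> x gx chix /(_ I) ->; rewrite /= chix.
case: (boolP (_ \in _)) => [|_]; last by rewrite scaler0 normr0.
rewrite in_itv/= => /andP[_ xa].
rewrite -(copson_below_support fab xa) -gx/= -[_ *: _]/(_ * _).
by rewrite mulr1.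
Qed.

Lemma copson_norm_le f a b : supp_in f `[a, b] ->
  chi J `[0, b] \in ideal_carrier X -> L1_inv_norm f \is a fin_num ->
  f \in ideal_carrier (copson_space X) /\
  ideal_norm (copson_space X) f <=
    ideal_norm X (chi J `[0, b]) * fine (L1_inv_norm f).
Proof.
move=> fab chiX Wfin.
have W0 : 0 <= fine (L1_inv_norm f) by rewrite fine_ge0// L1_inv_norm_ge0.
rewrite mulrC -[X in X * _](ger0_norm W0) -ideal_normZ//.
apply: copson_space_dominated; first exact: rpredZ.
have Jge0 : \forall x \ae mu, 0 <= (x : R).
  by apply/ae_lebI; apply: aeW => x; exact: base_set_ge0.
apply: filterS3 Jge0 (chiE `[0, b])
  (L0_scaleE (fine (L1_inv_norm f)) (chi J `[0, b])).
move=> x x0 chix /(_ I) ->; rewrite /= chix in_itv/= x0/=.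
have [xb|bx] := leP (x : R) b; last by rewrite (copson_above_support fab bx) lee_fin.
rewrite -[_ *: _]/(_ * _) mulr1 ger0_norm// fineK//.
exact: copson_le_L1_inv_norm.
Qed.

End copson_support.

(** * Transport of L1 along an affine bijection *)

Lemma measurable_abs d (T : measurableType d) (R : realType)
    (u : {mfun T >-> R}) (D : set T) :
  measurable_fun D (fun x => `|u x|%:E).
Proof.
apply: measurable_funTS; apply: measurableT_comp => //.
by apply: measurableT_comp => //; exact: measurable_funPT.
Qed.

Lemma ge0_integral_lebI (R : realType) (J : base_interval)
    (h : lebT R -> \bar R) :
  measurable_fun setT h -> (forall x, 0 <= h x)%E ->
  (\int[lebI J]_x h x = \int[leb]_(x in base_set J) h x)%E.
Proof.
move=> mh h0; have mJ := @measurable_base_set R J.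
rewrite (@ge0_negligible_integral _ _ _ (lebI J) setT (~` base_set J))//.
- rewrite setTD setCK; apply: eq_measure_integral => A mA AJ.
  by rewrite /= /lebI/= /mrestr setIidl.
- exact: measurableC.
- by rewrite /= /lebI/= /mrestr setICl.
Qed.

Lemma L1_spaceE (R : realType) (J : base_interval)
    (u : L0 (lebI J : {measure set (lebT R) -> \bar R})) :
  let I := (\int[leb]_(x in base_set J) `|u x|%:E)%E in
  (u \in ideal_carrier (L1_space (lebI J)) <-> I \is a fin_num) /\
  ideal_norm (L1_space (lebI J)) u = fine I.
Proof.
move=> I; have NI : ('N[lebI J]_1[EFin \o u] = I)%E.
  rewrite Lnorm1; apply: ge0_integral_lebI; last by move=> x; rewrite lee_fin.
  exact: measurable_abs.
have I0 : (0 <= I)%E by apply: integral_ge0.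
split; last by rewrite -NI.
rewrite ge0_fin_numE// -NI; split=> [/asboolP//|Ifin].
exact/asboolP.
Qed.

Section affine_operator.
Variable R : realType.

Definition cutoff (i : interval R) (v : lebT R -> R) (t : lebT R) : R :=
  ((t : R) \in i)%:R * v t.

Lemma measurable_cutoff i (v : R -> R) :
  measurable_fun setT v -> measurable_fun [set: lebT R] (cutoff i v).
Proof.
move=> mv; apply: measurable_funM; last exact: measurable_lebT.
have -> : (fun t : lebT R => ((t : R) \in i)%:R) = \1_[set` i] :> (lebT R -> R).
  by apply/funext => t; rewrite indicE mem_setE.
exact/measurable_indic/measurable_lebT_itv.
Qed.

Section op.
Variables (J1 J2 : base_interval) (i : interval R) (v : R -> R) (c s : R).
Hypotheses (mv : measurable_fun setT v) (s0 : 0 < s).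

Definition cutoff_mfun : {mfun lebT R >-> R} :=
  HB.pack (cutoff i v)
    (isMeasurableFun.Build _ _ (lebT R) R (cutoff i v) (measurable_cutoff i mv)).

Definition affine_mfun : {mfun lebT R >-> lebT R} :=
  HB.pack (affine c s)
    (isMeasurableFun.Build _ _ (lebT R) (lebT R) (affine c s) (measurable_affine c s0)).

Definition affine_op : L0 (lebI J2) -> L0 (lebI J1) :=
  @wcomp _ _ _ _ R (lebI J1) (lebI J2) cutoff_mfun affine_mfun.

Lemma affine_opE u :
  \forall t \ae lebI J1, affine_op u t = cutoff i v t * u (affine c s t).
Proof. exact: wcompE. Qed.

Hypothesis iJ : forall t : R, t \in i -> base_set J2 (affine c s t).

(** A null set of the second base interval may contain the complement of that
    interval; the image of [i] avoids this part. *)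
Lemma ae_affine_op (P : set (lebT R)) : (\forall x \ae lebI J2, P x) ->
  \forall t \ae lebI J1, (t : R) \in i -> P (affine c s t).
Proof.
move=> /ae_lebI/(ae_affine c s0) h; apply/ae_lebI.
by apply: filterS h => t Pt _ /iJ.
Qed.

Lemma affine_op_linear : linear affine_op.
Proof.
apply: wcomp_linear => P /ae_affine_op; apply: filterS => t Pt /=.
by rewrite /cutoff; case: (boolP (_ \in _)) => [/Pt//|_]; rewrite mul0r eqxx.
Qed.

Lemma affine_op_supp u : supp_in (affine_op u) i.
Proof.
apply: filterS (affine_opE u) => t ->; rewrite /cutoff.
by case: (_ \in _) => //; rewrite !mul0r eqxx.
Qed.

End op.
End affine_operator.

Section copy.
Context (R : realType) (J : base_interval) (a b : R).
Hypotheses (a0 : 0 < a) (ab : a < b) (b1 : b <= 1).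
Local Notation mu := (lebI J : {measure set (lebT R) -> \bar R}).
Local Notation U := UnitInterval.
Local Notation muU := (lebI U : {measure set (lebT R) -> \bar R}).

Let s0 : 0 < b - a. Proof. by rewrite subr_gt0. Qed.
Let sV0 : 0 < (b - a)^-1. Proof. by rewrite invr_gt0. Qed.

Local Notation psi := (affine a (b - a)).
Local Notation phi := (affine (- (a / (b - a))) (b - a)^-1).

Let phi_itv (t : R) : ((phi t : R) \in `[0, 1]) = (t \in `[a, b]).
Proof.
rewrite !in_itv/= (_ : (phi t : R) = (t - a) / (b - a)); last first.
  by rewrite /affine; field; rewrite gt_eqF.
rewrite ler_pdivlMr// ler_pdivrMr// mul0r mul1r subr_ge0.
by rewrite lerD2r.
Qed.

Let itv_base (t : R) : t \in `[a, b] -> base_set J t.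
Proof.
rewrite in_itv/= => /andP[ta tb]; have t0 : 0 <= t by rewrite (le_trans (ltW a0)).
by case: J; rewrite /= in_itv/= t0//= (le_trans tb).
Qed.

(** Cutting off outside [[a, b]], as a weighted composition with the identity
    map [t |-> 0 + 1 * t]. *)
Definition cut_op : L0 mu -> L0 mu :=
  affine_op J `[a, b] 0 (measurable_cst (1 : R)) ltr01.

Lemma cut_opE f : \forall t \ae mu, cut_op f t = ((t : R) \in `[a, b])%:R * f t.
Proof.
have := affine_opE J `[a, b] 0 (measurable_cst (1 : R)) ltr01 f.
apply: filterS => t ->.
by rewrite /cutoff /affine mulr1 add0r mul1r.
Qed.

Lemma cut_op_linear : linear cut_op.
Proof. by apply: affine_op_linear => t /itv_base; rewrite /affine add0r mul1r. Qed.

Lemma cut_op_supp f : supp_in (cut_op f) `[a, b].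
Proof. exact: affine_op_supp. Qed.

Lemma cut_op_id f : supp_in f `[a, b] -> cut_op f = f.
Proof.
move=> fab; apply/L0_eqP; apply: filterS2 fab (cut_opE f) => t ft -> _.
have [->|/ft ->] := eqVneq (f t) 0; first by rewrite mulr0.
by rewrite mul1r.
Qed.

(** The map [u |-> t * u (phi t)] from functions on [[0, 1]] to functions supported
    in [[a, b]].  The factor [t] cancels the weight [1/t]. *)
Definition spread_op : L0 muU -> L0 mu :=
  affine_op J `[a, b] (- (a / (b - a))) (@measurable_id _ _ _) sV0.

Lemma spread_opE u : \forall t \ae mu,
  spread_op u t = ((t : R) \in `[a, b])%:R * t * u (phi t).
Proof. exact: affine_opE. Qed.

Let mVpsi : measurable_fun setT (fun x : R => (a + (b - a) * x)^-1).
Proof.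
apply: measurableT_comp; first exact: measurable_inv.
by apply: measurable_funD => //; apply: measurable_funM.
Qed.

(** The inverse [f |-> f (psi x) / psi x] of [spread_op]. *)
Definition gather_op : L0 mu -> L0 muU :=
  affine_op U `[0, 1] a mVpsi s0.

Lemma gather_opE f : \forall x \ae muU,
  gather_op f x = ((x : R) \in `[0, 1])%:R * (psi x : R)^-1 * f (psi x).
Proof. exact: affine_opE. Qed.

Let phi_base (t : R) : t \in `[a, b] -> base_set U (phi t).
Proof. by rewrite -phi_itv. Qed.

Lemma spread_op_linear : linear spread_op.
Proof. by apply: affine_op_linear => t /phi_base. Qed.

Lemma spread_op_supp u : supp_in (spread_op u) `[a, b].
Proof. exact: affine_op_supp. Qed.

Lemma gather_opK f : supp_in f `[a, b] -> spread_op (gather_op f) = f.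
Proof.
move=> fab; apply/L0_eqP.
have h := ae_affine_op J sV0 phi_base (gather_opE f).
apply: filterS3 fab h (spread_opE (gather_op f)) => t ft ht -> _.
case: (boolP (_ \in _)) => [tab|]; last first.
  have [->|/ft ->//] := eqVneq (f t) 0.
  by rewrite !mul0r.
have t0 : (t : R) != 0.
  by rewrite gt_eqF// (lt_le_trans a0)//; move: tab; rewrite in_itv/= => /andP[].
rewrite ht// phi_itv tab !mul1r.
rewrite affineVK ?gt_eqF//.
by rewrite mulrA mulfV// mul1r.
Qed.

(** The integrand on the left is [|u (phi t)|] on [[a, b]], so the substitution
    [x = phi t], of slope [1 / (b - a)], gives the right-hand side. *)
Lemma L1_inv_norm_spread u : L1_inv_norm (spread_op u) =
  ((b - a)%:E * \int[leb]_(x in base_set U) `|u x|%:E)%E.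
Proof.
have mD : measurable (phi @^-1` (base_set U : set (lebT R))).
  rewrite -[X in measurable X]setTI; apply: measurable_affine => //.
  exact: measurable_base_set.
have DJ : phi @^-1` (base_set U : set (lebT R)) `<=` base_set J.
  by move=> t /= ht; apply: itv_base; rewrite -phi_itv.
have -> : ((b - a)%:E * \int[leb]_(x in base_set U) `|u x|%:E =
    \int[leb]_(t in phi @^-1` base_set U) `|u (phi t)|%:E)%E.
  rewrite -[X in (X%:E * _)%E]invrK; apply/esym.
  apply: (@ge0_integral_affine _ _ _ _ (fun x => `|u x|%:E)).
  - exact: sV0.
  - exact: measurable_base_set.
  - exact: measurable_abs.
  - by move=> x _; rewrite lee_fin.
rewrite /L1_inv_norm; transitivity
    (\int[leb]_(t in phi @^-1` base_set U) (`|spread_op u t| / (t : R))%:E)%E.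
  apply/esym/ge0_integral_support.
  - exact: mD.
  - exact: measurable_base_set.
  - exact: DJ.
  - exact: measurable_copson_integrand.
  - by move=> t; exact: copson_integrand_ge0.
  - have /ae_lebI := spread_op_supp u; apply: filterS => t ut Jt nD.
    have [->|/(ut Jt)] := eqVneq (spread_op u t) 0; first by rewrite normr0 mul0r.
    by rewrite -phi_itv => /nD.
apply: ge0_ae_eq_integral.
- exact: mD.
- exact: measurable_copson_integrand.
- exact: (measurable_abs ((u : {mfun lebT R >-> R}) \o affine_mfun _ sV0)).
- by move=> t /DJ; exact: copson_integrand_ge0.
- by move=> t _; rewrite lee_fin.
have /ae_lebI := spread_opE u.
apply: filterS => t ut Dt; rewrite ut; last exact: DJ.
have tab : (t : R) \in `[a, b] by rewrite -phi_itv.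
have t0 : 0 < (t : R) by rewrite (lt_le_trans a0)//; move: tab; rewrite in_itv/= => /andP[].
rewrite tab mul1r normrM gtr0_norm//; congr (_%:E).
by rewrite mulrAC mulfV ?gt_eqF// mul1r.
Qed.

Variable X : ideal_space mu.
Hypothesis chiaX : chi J `[0, a] \in ideal_carrier X.
Hypothesis chibX : chi J `[0, b] \in ideal_carrier X.

(** The copy is the range of the cut-off projection, and the isomorphism is the
    restriction of [spread_op]: its upper and lower bounds are those of
    [copson_norm_le] and [copson_norm_ge], read through [L1_inv_norm_spread]. *)
Lemma copson_contains_L1 : contains_complemented_copy
  (ideal_type (L1_space muU)) (ideal_type (copson_space X)).
Proof.
have cut_bd f : f \in ideal_carrier (copson_space X) ->
    cut_op f \in ideal_carrier (copson_space X) /\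
    ideal_norm (copson_space X) (cut_op f) <= 1 * ideal_norm (copson_space X) f.
  move=> fX; rewrite mul1r; apply: idealP => //.
  apply: filterS (cut_opE f) => t ->.
  by case: (_ \in _); rewrite ?mul1r// mul0r normr0.
have [P [cP PE]] := bounded_operator cut_op_linear cut_bd.
have PP f : P (P f) = P f.
  by apply/val_inj; rewrite /= !PE; apply: cut_op_id; exact: cut_op_supp.
exists (range P); split; first exact: complemented_range.
have normL1 (u : L0 muU) : u \in ideal_carrier (L1_space muU) ->
    L1_inv_norm (spread_op u) \is a fin_num /\
    fine (L1_inv_norm (spread_op u)) = (b - a) * ideal_norm (L1_space muU) u.
  have [uL ->] := L1_spaceE u; move=> /uL ufin.
  by rewrite L1_inv_norm_spread fin_numM// fineM.
pose k := ideal_norm X (chi J `[0, b]) * (b - a).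
have spread_bd u : u \in ideal_carrier (L1_space muU) ->
    spread_op u \in ideal_carrier (copson_space X) /\
    ideal_norm (copson_space X) (spread_op u) <= k * ideal_norm (L1_space muU) u.
  move=> /normL1[Wfin Wu]; rewrite -mulrA -Wu.
  by apply: copson_norm_le => //; exact: spread_op_supp.
have [T [cT TE]] := bounded_operator spread_op_linear spread_bd.
exists T; split=> //.
  exists (ideal_norm X (chi J `[0, a]) * (b - a)).
    rewrite mulr_gt0// lt_neqAle; apply/andP; split; last first.
      exact: ideal_norm_ge0.
    rewrite eq_sym; apply/eqP => /(ideal_norm_eq0 chiaX)/eqP.
    by apply/negP; exact: chi_neq0.
  move=> u; move: (u : ideal_type (L1_space muU)) => {}u.
  have uL : ideal_val u \in ideal_carrier (L1_space muU) by exact: valP.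
  have [_ Wu] := normL1 _ uL.
  rewrite -[`|u|]/(ideal_norm (L1_space muU) u).
  rewrite -[`|T u|]/(ideal_norm (copson_space X) (ideal_val (T u))).
  rewrite TE -mulrA -Wu; apply: copson_norm_ge a0 _ chiaX _.
    exact: spread_op_supp.
  by have [] := spread_bd _ uL.
rewrite range_projection//; apply/seteqP; split=> [_ [u _ <-]/=|f /= Pf].
  by apply/val_inj; rewrite /= PE TE; apply: cut_op_id; exact: spread_op_supp.
have fab : supp_in (ideal_val f) `[a, b] by rewrite -Pf PE; exact: cut_op_supp.
have Tf : spread_op (gather_op (ideal_val f)) = ideal_val f by exact: gather_opK.
(* The preimage of f is integrable because f has finite L1(1/t) norm. *)
have uL : gather_op (ideal_val f) \in ideal_carrier (L1_space muU).
  have [uL _] := L1_spaceE (gather_op (ideal_val f)); apply/uL.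
  have := copson_space_supp_fin a0 fab (valP f).
  rewrite -[X in L1_inv_norm X]Tf L1_inv_norm_spread => Wfin.
  rewrite ge0_fin_numE; last by apply: integral_ge0.
  rewrite ltey; apply: contraTneq Wfin => ->.
  by rewrite gt0_muley// lte_fin.
exists (exist _ (gather_op (ideal_val f)) uL) => //.
by apply/val_inj; rewrite /= TE.
Qed.

End copy.

(** If [C f] vanished at every point of ]0, 1[ it would vanish on ]0, +oo[ by
    monotonicity, and [f] would have norm 0.  So [C f] has a positive lower
    bound on some [[0, b]]. *)
Lemma exists_chi (R : realType) (J : base_interval)
    (X : ideal_space (lebI J : {measure set (lebT R) -> \bar R}))
    (f : ideal_type (copson_space X)) : f != 0 ->
  exists b : R, [/\ 0 < b, b < 1 & chi J `[0, b] \in ideal_carrier X].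
Proof.
move=> fN0; have /copson_spaceP[g gX fg] := valP f.
pose C := copson J (fun t => `|ideal_val f t|%R).
have [b [b0 b1 Cb]] : exists b : R, [/\ 0 < b, b < 1 & (0 < C b)%E].
  apply: contrapT => nb; move/eqP: fN0; apply; apply/val_inj => /=.
  apply: (ideal_norm_eq0 (valP f)); rewrite (copson_space_norm X fg).
  suff -> : g = 0.
    by rewrite -(scale0r (0 : L0 (lebI J))) ideal_normZ ?normr0 ?mul0r// rpred0.
  apply/L0_eqP.
  have N0 : \forall x \ae lebI J, 0 < (x : R).
    apply/ae_lebI; exists [set (0 : R)]; split.
    - by have := @measurable_lebT_itv R `[0, 0]; rewrite set_itv1.
    - have -> : leb ([set (0 : R)] : set (lebT R)) = lebesgue_measure [set (0 : R)] by [].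
      by rewrite lebesgue_measure_set1.
    - move=> x /= /not_implyP[/base_set_ge0 x0 /negP].
      by rewrite -leNgt => x0'; apply: (@le_anti _ R); rewrite x0'.
  apply: filterS3 fg N0 (L0_zeroE _) => x gx x0 /(_ I) -> _.
  apply: EFin_inj; rewrite gx; apply/eqP; rewrite eq_le copson_ge0 andbT.
  rewrite leNgt; apply/negP => Cx; apply: nb; exists (Num.min x 2^-1).
  split; [by rewrite lt_min x0 invr_gt0 ltr0n| |].
    by rewrite gt_min invf_lt1 ?ltr1n ?orbT.
  by apply: lt_le_trans Cx _; apply: copson_noninc; rewrite ge_min lexx.
(* C f may be infinite at b itself, hence the detour through a real d. *)
have [d d0 dC] : exists2 d : R, 0 < d & (d%:E <= C b)%E.
  move: Cb; case: (C b) => [r r0|_|//]; first by exists r.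
  by exists 1 => //; rewrite leey.
exists b; split=> //.
have dgX : d^-1 *: g \in ideal_carrier X by exact: rpredZ.
have [|//] := idealP (f := chi J `[0, b]) dgX.
apply: filterS3 fg (chiE J `[0, b]) (L0_scaleE d^-1 g) => x gx -> /(_ I) ->.
case: (boolP (_ \in _)) => [|_]; last by rewrite normr0.
rewrite in_itv/= => /andP[_ xb]; rewrite normr1 normrM gtr0_norm ?invr_gt0//.
rewrite ler_pdivlMl// mulr1 -lee_fin.
apply: le_trans dC _; apply: (@le_trans _ _ (g x)%:E); last by rewrite lee_fin ler_norm.
by rewrite gx; exact: copson_noninc.
Qed.

Unset Implicit Arguments.

Theorem lemma4p2 (R : realType) (J : base_interval)
    (X : banach_function_space (lebI J : {measure set (lebT R) -> \bar R}))
    (nontrivial : exists f : ideal_type (copson_space X), f != 0) :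
  (exists a b : R,
    [/\ 0 < a, a < b & (b%:E < leb (base_set J : set (lebT R)))%E] /\
    [/\ chi J `[0, a] \in ideal_carrier X,
        chi J `[0, b] \in ideal_carrier X &
        forall f : ideal_type (copson_space X), supp_in f `[a, b] ->
          ((ideal_norm X (chi J `[0, a]))%:E * L1_inv_norm f <= `|f|%:E)%E /\
          (`|f|%:E <= (ideal_norm X (chi J `[0, b]))%:E * L1_inv_norm f)%E]) /\
  contains_complemented_copy
    (ideal_type (L1_space (lebI UnitInterval : {measure set (lebT R) -> \bar R})))
    (ideal_type (copson_space X)).
Proof.
have [f0 f0N0] := nontrivial; have [b [b0 b1 chib]] := exists_chi f0N0.
pose a := b / 2.
have a0 : 0 < a by rewrite divr_gt0.
have ab : a < b by rewrite ltr_pdivrMr// mulr_natr mulr2n ltrDl.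
have chia : chi J `[0, a] \in ideal_carrier X.
  have [|//] := idealP (f := chi J `[0, a]) chib.
  apply: filterS2 (chiE J `[0, a]) (chiE J `[0, b]) => x -> ->.
  rewrite !in_itv/=; case: (0 <= _) => //=.
  case: (boolP (_ <= a)) => [xa|_]; last by rewrite normr0.
  by rewrite (le_trans xa)// ltW.
split; last exact: (copson_contains_L1 a0 ab (ltW b1) chia chib).
exists a, b; split; split=> //.
  apply: (@lt_le_trans _ _ 1%E); first by rewrite lte_fin.
  have e01 : leb ([set` `[0%R, 1%R]%R] : set (lebT R)) = 1%E.
    rewrite [LHS](_ : _ = lebesgue_measure [set` `[0%R, 1%R]%R])//.
    by rewrite lebesgue_measure_itv/= lte_fin ltr01 oppr0 adde0.
  rewrite -e01; apply: le_measure; rewrite ?inE.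
  - exact: measurable_lebT_itv.
  - exact: measurable_base_set.
  - suff sub K : ([set` `[0%R, 1%R]%R] : set (lebT R)) `<=` base_set K by exact: sub.
    by case: K => // x /=; rewrite !in_itv/= => /andP[->].
move=> f fab; have fX : ideal_val f \in ideal_carrier (copson_space X) by exact: valP.
have Wfin := copson_space_supp_fin a0 fab fX.
rewrite -(fineK Wfin) -!EFinM !lee_fin; split.
  exact: copson_norm_ge a0 fab chia fX.
by have [] := copson_norm_le fab chib Wfin.
Qed.
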